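(* Let $G=(V,E)$ be a one-ended graph that has connected minimal cutsets between any pair of vertices, i.e., for all $x,y\in V$ every minimal cutset separating $x$ from $y$ is connected in $G$. Then $$p_u(G)\le \overline p_u(G)\le \max\{p_c(G),\,1-p_c(G)\}.$$
   Context: $G$ is one-ended if for any finite set $\Gamma\subset V$ the induced subgraph on $V\setminus\Gamma$ has a unique infinite connected component. For $x,y\in V$, a set $\Gamma\subset V$ is a cutset separating $x$ from $y$ if any path from $x$ to $y$ in $G$ intersects $\Gamma$; it is a minimal cutset if for all $w\in\Gamma$ the set $\Gamma\setminus\{w\}$ is no longer a cutset. A set of vertices is connected in $G$ if it induces a connected subgraph. $\mathbb{P}_p$ denotes the law of Bernoulli site percolation on $G$ with parameter $p$ (each vertex is independently open with probability $p$ and closed otherwise). A cluster is a connected component of the set of open vertices. Define $$p_c(G)=\sup\{p\in[0,1]:\mathbb{P}_p(\text{there exists an infinite cluster in }G)=0\},$$ $$p_u(G)=\sup\{p\in[0,1]:\mathbb{P}_p(\text{there exists a unique infinite cluster in }G)<1\},$$ and let $\overline p_u(G)$ be the supremum of all $p\in[0,1]$ such that $$\mathbb{P}_p(\text{there exists an infinite cluster }C\text{ in }G\text{ such that }G\setminus C\text{ does not contain an infinite connected component})<1.$$ *)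

(* Defs.v *)
From HB Require Import structures.
From mathcomp Require Import all_boot all_order all_algebra.
From mathcomp Require Import all_classical all_reals all_analysis.
From mathcomp Require Import measurable_realfun.
From mathcomp Require Import zify ring lra.
Set Implicit Arguments.
Unset Strict Implicit.
Unset Printing Implicit Defensive.
Import Order.TTheory GRing.Theory Num.Theory.
Local Open Scope classical_set_scope.
Local Open Scope ring_scope.

(* Simple graphs are symmetric irreflexive relations [e] on the vertex type. *)
Section graphs.
Context {V : eqType}.
Implicit Types (e : rel V) (S C Gamma : set V) (x y : V).

(* [x] and [y] are joined by a finite path of [e] all of whose vertices,
   endpoints included, lie in [S]. *)
Definition linked e S x y :=
  exists p : seq V, [/\ path e x p, last x p = y &
    forall z, z \in x :: p -> S z].

(* The empty set counts as connected. *)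
Definition connected_in e S := forall x y, S x -> S y -> linked e S x y.

(* [C] is a connected component of the subgraph induced on [S]. *)
Definition component e S C := exists2 x, S x & C = linked e S x.

Definition infinite_component e S C := component e S C /\ infinite_set C.

Definition one_ended e := forall Gamma, finite_set Gamma ->
  exists! C, infinite_component e (~` Gamma) C.

(* Endpoints are vertices of the path, so [Gamma] may contain [x] or [y];
   [Gamma] may also be infinite. *)
Definition cutset e x y Gamma :=
  forall p : seq V, path e x p -> last x p = y ->
    exists2 z, z \in x :: p & Gamma z.

Definition minimal_cutset e x y Gamma :=
  cutset e x y Gamma /\
  forall w, Gamma w -> ~ cutset e x y (Gamma `\ w).

Definition connected_minimal_cutsets e := forall x y Gamma,
  minimal_cutset e x y Gamma -> connected_in e Gamma.

End graphs.

(* The product Bernoulli measure on a countable product is not in the library.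
   It is obtained below as the joint law, under the uniform law on [0, 1], of
   the events "the n-th iterate of [digit_shift] is < p". *)
Section digits.
Context {R : realType}.
Variable p : R.
Implicit Types (x : R) (s : nat -> bool).

Definition digit_shift x : R := if x < p then x / p else (x - p) / (1 - p).

Definition digit n x : bool := iter n digit_shift x < p.

Hypothesis p01 : 0 <= p <= 1.

Lemma digit_itv n s : exists2 a : R, 
  (0 <= a /\ a + \prod_(i < n) bernoulli_pmf p (s i) <= 1) &
  [set x | 0 <= x < 1 /\ forall i, (i < n)%N -> digit i x = s i] =
  `[a, a + \prod_(i < n) bernoulli_pmf p (s i)[%classic.
Proof.
have [p0 p1] := andP p01.
elim: n s => [|n IH] s.
  exists 0; rewrite big_ord0 ?add0r //.
  by apply/seteqP; split => x /=; rewrite in_itv /=; [case|split].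
have [a [a0 aw1] aE] := IH (s \o S).
rewrite big_ord_recl /=.
move: aw1 aE.
set w := \prod_(i < n) _ => aw1 aE.
have w0 : 0 <= w by apply: prodr_ge0 => i _; exact: bernoulli_pmf_ge0.
have {}aE y : (a <= y < a + w) <->
  (0 <= y < 1 /\ forall i, (i < n)%N -> digit i y = s i.+1).
  by have := congr1 (fun A : set R => A y) aE; rewrite /= in_itv /= => ->.
have dS i x : digit i.+1 x = digit i (digit_shift x).
  by rewrite /digit iterSr.
have d0 x : digit 0 x = (x < p) by [].
case s0 : (s 0%N); rewrite /bernoulli_pmf.
- exists (p * a); first by split; nra.
  apply/seteqP; split => x /=; rewrite in_itv /=.
    move=> [x01 xs].
    have xp : x < p by rewrite -d0 xs.
    have pp : 0 < p by lra.
    have : a <= x / p < a + w.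
      apply/aE; split.
        rewrite divr_ge0 //=; last by lra.
        by rewrite ltr_pdivrMr // mul1r.
      by move=> i lin; rewrite -xs // dS /digit_shift xp.
    by rewrite ler_pdivlMr // ltr_pdivrMr // => /andP[]; nra.
  move=> /andP[h1 h2].
  have pp : 0 < p by rewrite lt_def p0 andbT; apply/eqP => pE; move: h1 h2; rewrite pE; nra.
  have /aE[/andP[xp0 xp1] xs] : a <= x / p < a + w.
    by rewrite ler_pdivlMr // ltr_pdivrMr //; apply/andP; split; nra.
  have xp : x < p by move: xp1; rewrite ltr_pdivrMr // mul1r.
  split; first by move: xp0; rewrite ler_pdivlMr // mul0r; lra.
  case=> [_|i lin]; first by rewrite d0 xp s0.
  by rewrite dS /digit_shift xp xs.
- exists (p + (1 - p) * a); first by split; nra.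
  apply/seteqP; split => x /=; rewrite in_itv /=.
    move=> [x01 xs].
    have xp : p <= x by rewrite leNgt -d0 xs // s0.
    have pp : 0 < 1 - p by lra.
    have : a <= (x - p) / (1 - p) < a + w.
      apply/aE; split.
        rewrite divr_ge0 //=; [|lra..].
        by rewrite ltr_pdivrMr // mul1r; lra.
      by move=> i lin; rewrite -xs // dS /digit_shift ltNge xp.
    by rewrite ler_pdivlMr // ltr_pdivrMr // => /andP[]; nra.
  move=> /andP[h1 h2].
  have pp : 0 < 1 - p.
    rewrite lt_def subr_ge0 p1 andbT; apply/eqP => pE.
    by move: h1 h2; rewrite pE; nra.
  have /aE[/andP[xp0 xp1] xs] : a <= (x - p) / (1 - p) < a + w.
    by rewrite ler_pdivlMr // ltr_pdivrMr //; apply/andP; split; nra.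
  have xp : p <= x by move: xp0; rewrite ler_pdivlMr // mul0r; lra.
  split; first by move: xp1; rewrite ltr_pdivrMr // mul1r; lra.
  case=> [_|i lin]; first by rewrite d0 ltNge xp s0.
  by rewrite dS /digit_shift ltNge xp xs.
Qed.

Let U01 : probability (measurableTypeR R) R := uniform_prob (@ltr01 R).

Lemma measurable_digit_shift : measurable_fun setT digit_shift.
Proof.
apply: measurable_fun_if => //=.
- exact: measurable_fun_ltr.
- by apply: measurable_funM.
- by apply: measurable_funM => //; apply: measurable_funB.
Qed.

Lemma measurable_digit n : measurable [set x | digit n x].
Proof.
have mi : measurable_fun setT (iter n digit_shift).
  elim: n => [|n IH]; first exact: measurable_id.
  exact: (measurableT_comp measurable_digit_shift IH).
rewrite (_ : [set x | _] = setT `&` iter n digit_shift @^-1` `]-oo, p[%classic).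
  by apply: mi.
by apply/seteqP; split => x /=; rewrite in_itv/= /digit => //; case.
Qed.

Lemma measurable_digitb n b : measurable [set x | digit n x = b].
Proof.
case: b; first exact: measurable_digit.
rewrite (_ : [set x | _] = ~` [set x | digit n x]).
  by apply: measurableC; exact: measurable_digit.
by apply/seteqP; split => x /=; case: digit.
Qed.

Lemma measurable_digits (L : seq nat) s :
  measurable [set x | forall i, i \in L -> digit i x = s i].
Proof.
rewrite (_ : [set x | _] =
  \big[setI/setT]_(i <- L) [set x | digit i x = s i]).
  by apply: bigsetI_measurable => i _; exact: measurable_digitb.
by rewrite -bigcap_seq; apply/seteqP; split => x /=.
Qed.

Lemma uniform_itv (a w : R) : 0 <= a -> 0 <= w -> a + w <= 1 ->
  U01 `[a, a + w[%classic = w%:E.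
Proof.
move=> a0 w0 aw1; rewrite /U01 /= /uniform_prob.
rewrite (eq_integral (fun=> 1%:E)); last first.
  move=> x; rewrite inE/= in_itv/= /uniform_pdf => /andP[ax xw].
  by rewrite subr0 invr1 ifT //; apply/andP; split; lra.
rewrite integral_cst //= mul1e lebesgue_measure_itv /= lte_fin.
case: ifPn => [_|]; first by rewrite -EFinB; congr EFin; ring.
by rewrite -leNgt => ?; congr EFin; lra.
Qed.

Lemma uniform_digits (L : seq nat) s : uniq L ->
  U01 [set x | forall i, i \in L -> digit i x = s i] =
  (\prod_(i <- L) bernoulli_pmf p (s i))%:E.
Proof.
have [n Ln] : exists n, forall i, i \in L -> (i < n)%N.
  exists (\max_(i <- L) i).+1 => i iL; rewrite ltnS.
  by rewrite (big_rem i) //= leq_maxl.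
have [m] := ubnP (n - size L); elim: m L s Ln => // m IH L s Ln mL uL.
have [/allP Lfull|/allPn[k kn kL]] := boolP (all (mem L) (iota 0 n)).
  have pL : perm_eq L (iota 0 n).
    apply: uniq_perm => //; first exact: iota_uniq.
    move=> i; apply/idP/idP => [/Ln|/Lfull//].
    by rewrite mem_iota.
  rewrite (perm_big _ pL) /=.
  have [a [a0 aw] aE] := digit_itv n s.
  have w0 : 0 <= \prod_(i < n) bernoulli_pmf p (s i).
    by apply: prodr_ge0 => i _; exact: bernoulli_pmf_ge0.
  have -> : \prod_(i <- iota 0 n) bernoulli_pmf p (s i) =
    \prod_(i < n) bernoulli_pmf p (s i).
    by rewrite -(big_mkord xpredT (fun i => bernoulli_pmf p (s i))) /index_iota subn0.
  rewrite -(uniform_itv a0 w0 aw) -aE.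
  have -> : [set x | 0 <= x < 1 /\ forall i, (i < n)%N -> digit i x = s i] =
     [set x | forall i, i \in L -> digit i x = s i] `&` `[0, 1[%classic.
    apply/seteqP; split => x /=; rewrite in_itv/=.
      by move=> [x01 xs]; split => // i /Ln/xs.
    by move=> [xs x01]; split => // i ni; apply/xs/Lfull; rewrite mem_iota.
  have U1 : U01 `[0, 1[%classic = 1%E.
    by rewrite -[X in `[0, X[](add0r 1) uniform_itv // add0r.
  have mL' := measurable_digits L s.
  have UC : U01 (~` `[0, 1[%classic) = 0%E.
    by rewrite probability_setC // [X in (1 - X)%E]U1 subee.
  rewrite -[in LHS](setIT [set x | _]) -(setUv `[0, 1[%classic) setIUr.
  rewrite measureU //; last 3 first.
  - exact: measurableI.
  - by apply: measurableI => //; exact: measurableC.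
  - by rewrite setIACA setICr setI0.
  rewrite [X in (_ + X)%E](_ : _ = 0%E) ?adde0 //.
  apply/eqP; rewrite eq_le measure_ge0 andbT -[X in (_ <= X)%E]UC.
  apply: le_measure; rewrite ?inE.
  - by apply: measurableI => //; exact: measurableC.
  - exact: measurableC.
  - exact: subIsetr.
have kn' : (k < n)%N by move: kn; rewrite mem_iota.
pose t b i := if i == k then b else s i.
have ukL : uniq (k :: L) by rewrite /= kL.
have sizeL : (size L < n)%N.
  have : (size (k :: L) <= size (iota 0 n))%N.
    apply: uniq_leq_size => // i; rewrite inE mem_iota => /orP[/eqP->//|/Ln//].
  by rewrite size_iota.
have tE b := IH (k :: L) (t b).
have {}tE b : U01 [set x | forall i, i \in k :: L -> digit i x = t b i] =
   (bernoulli_pmf p b * \prod_(i <- L) bernoulli_pmf p (s i))%:E.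
  rewrite tE //=.
  - rewrite big_cons /t eqxx; congr (_ * _)%:E.
    apply: eq_big_seq => i iL; case: eqP => // ik.
    by move: kL; rewrite /= -ik iL.
  - by move=> i; rewrite inE => /orP[/eqP->//|/Ln].
  - by move: mL => /=; lia.
have -> : [set x | forall i, i \in L -> digit i x = s i] =
  [set x | forall i, i \in k :: L -> digit i x = t true i] `|`
  [set x | forall i, i \in k :: L -> digit i x = t false i].
  apply/seteqP; split => x /=.
    move=> xs; case dk : (digit k x); [left|right] => i; rewrite inE /t.
      by case: eqP => [->//|_ /= /xs].
    by case: eqP => [->//|_ /= /xs].
  move=> H i iL; have ik : (i == k) = false.
    by apply/eqP => ik; move: kL; rewrite /= -ik iL.
  by case: H => /(_ i); rewrite inE iL orbT /t ik; apply.
rewrite measureU; [|exact: measurable_digits..|]; last first.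
  apply/seteqP; split => x //= -[/(_ k) + /(_ k)].
  by rewrite inE eqxx /t eqxx => -> // /(_ isT).
rewrite [X in (X + _)%E](tE true) [X in (_ + X)%E](tE false) -EFinD.
by congr EFin; rewrite /bernoulli_pmf /=; ring.
Qed.

End digits.

(* [w v] means that the vertex [v] is open. *)
Definition cylinders (V : Type) : set (set (V -> bool)) :=
  [set [set w : V -> bool | w v] | v in [set: V]].

Notation config V := (g_sigma_algebraType (@cylinders V)).

(* The vertices are independently open with probability [p]: product formula
   for all finite-dimensional marginals. As the cylinders form a pi-system
   generating the sigma-algebra, this determines [P]. *)
Definition bernoulli_site (V : eqType) (R : realType) (p : R)
    (P : probability (config V) R) :=
  forall (A : seq V) (s : V -> bool), uniq A ->
    P [set w | forall v, v \in A -> w v = s v] =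
    (\prod_(v <- A) bernoulli_pmf p (s v))%:E.

Lemma bernoulli_site_exists (V : countType) (R : realType) (p : R) :
  exists P : probability (config V) R, 0 <= p <= 1 -> bernoulli_site p P.
Proof.
pose X (x : measurableTypeR R) : config V := fun v => digit p (pickle v) x.
have mX : measurable_fun setT X.
  apply: (@measurability _ _ (measurableTypeR R) (config V) setT X (@cylinders V)) => //.
  move=> _ [_ [v _ <-] <-]; rewrite setTI.
  exact: measurable_digit.
pose U : probability (measurableTypeR R) R := uniform_prob (@ltr01 R).
pose Xm : {mfun measurableTypeR R >-> config V} :=
  HB.pack X (isMeasurableFun.Build _ _ _ _ X mX).
exists (distribution U Xm) => p01 A s uA.
rewrite /distribution /pushforward /=.
pose s' n := if @pickle_inv V n is Some v then s v else false.
have sE v : s' (pickle v) = s v by rewrite /s' pickleK_inv.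
rewrite (eq_bigr (fun v => bernoulli_pmf p (s' (pickle v)))); last first.
  by move=> v _; rewrite sE.
rewrite -(big_map pickle xpredT (fun n => bernoulli_pmf p (s' n))).
rewrite -uniform_digits //; last by rewrite map_inj_uniq //; exact: pcan_inj pickleK.
congr (uniform_prob _ _); apply/seteqP; split => x /=.
  by move=> H _ /mapP[v vA ->]; rewrite sE -H.
by move=> H v vA; rewrite -sE -H //; exact: map_f.
Qed.

Definition site_law (V : countType) (R : realType) (p : R) :
  probability (config V) R := sval (cid (bernoulli_site_exists V p)).

Lemma site_lawP (V : countType) (R : realType) (p : R) :
  0 <= p <= 1 -> bernoulli_site p (@site_law V R p).
Proof. exact: svalP (cid (bernoulli_site_exists V p)). Qed.

Section percolation.
Context (R : realType) {V : countType}.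
Implicit Types (e : rel V) (w : config V) (C : set V).

Definition infinite_cluster e w C := infinite_component e [set v | w v] C.

Definition some_infinite_cluster e : set (config V) :=
  [set w | exists C, infinite_cluster e w C].

Definition unique_infinite_cluster e : set (config V) :=
  [set w | exists! C, infinite_cluster e w C].

Definition cluster_without_infinite_complement e : set (config V) :=
  [set w | exists2 C, infinite_cluster e w C &
     ~ exists D, infinite_component e (~` C) D].

Definition p_c e : R :=
  sup [set p : R | 0 <= p <= 1 /\
    site_law V p (some_infinite_cluster e) = 0%E].

Definition p_u e : R :=
  sup [set p : R | 0 <= p <= 1 /\
    (site_law V p (unique_infinite_cluster e) < 1)%E].

Definition pbar_u e : R :=
  sup [set p : R | 0 <= p <= 1 /\
    (site_law V p (cluster_without_infinite_complement e) < 1)%E].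

End percolation.

(* Main.v *)
From HB Require Import structures.
Require Import Defs.
From mathcomp Require Import all_boot all_order all_algebra.
From mathcomp Require Import all_classical all_reals all_analysis.
From mathcomp Require Import ring lra.
Set Implicit Arguments.
Unset Strict Implicit.
Unset Printing Implicit Defensive.
Import Order.TTheory GRing.Theory Num.Theory.
Local Open Scope classical_set_scope.
Local Open Scope ring_scope.

(** The first inequality compares events: if the complement of an infinite
cluster [C] has no infinite component, then [C] is the only infinite cluster,
since another one would be an infinite connected set in that complement.

For the second inequality, suppose first that some vertex has infinite degree.
As soon as it is open it has infinitely many open neighbours almost surely,
whatever the parameter [p > 0]; hence [p_c <= 0] and the bound is at least [1]
([p_c_infinite_degree]).

Suppose now that the graph is locally finite, and let [p] exceed both [p_c] and
[1 - p_c]. An infinite cluster exists with positive probability, hence almost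
surely, as its existence does not depend on finitely many vertices
([bernoulli_zero_one], [some_infinite_cluster_close_on]). The closed vertices
form a Bernoulli configuration of parameter [1 - p < p_c], so by monotonicity in
the parameter ([bernoulli_increasing]) they almost surely have no infinite
component. It remains to see that these two facts exclude an infinite component
[D] of the complement of an infinite cluster [C]
([infinite_component_complement]). The vertices of [D] adjacent to [C] are
closed. There are infinitely many of them, because finitely many could not
separate [C] from [D] in a one-ended graph ([infinite_boundary]). And they form
a connected set ([connected_boundary]): each component of [D] minus this
boundary sees a part of it that is a minimal cutset, hence connected, and these
parts are chained together by the connectedness of [D]. So they lie in an
infinite component of closed vertices, a contradiction.

Measures on configurations are identified through the pi-system of the events
that all vertices of a finite list are closed. These events suit the operations
used here: their preimages under the union of two configurations and under the
closing of finitely many vertices are products of such events, or such events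
again. *)

(** * Connectivity inside a set of vertices *)

Section linked.
Context {V : eqType}.
Implicit Types (e : rel V) (S T C D Gamma : set V) (x y z : V).

Lemma linked_refl e S x : S x -> linked e S x x.
Proof. by move=> Sx; exists [::]; split=> // z; rewrite inE => /eqP->. Qed.

Lemma linked_left e S x y : linked e S x y -> S x.
Proof. by move=> [p [_ _]]; apply; rewrite inE eqxx. Qed.

Lemma linked_right e S x y : linked e S x y -> S y.
Proof. by move=> [p [_ <-]]; apply; exact: mem_last. Qed.

Lemma linked_step e S x y z : linked e S x y -> e y z -> S z -> linked e S x z.
Proof.
move=> [p [pp lp pS]] eyz Sz; exists (rcons p z); split.
- by rewrite rcons_path pp lp.
- by rewrite last_rcons.
- move=> t; rewrite -rcons_cons mem_rcons inE => /orP[/eqP->//|].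
  exact: pS.
Qed.

(** Induction along a path by its last edge. Connectivity arguments below show
in this way that a property propagates from neighbour to neighbour. *)
Lemma linked_ind e S x (P : V -> Prop) :
  (S x -> P x) ->
  (forall y z, linked e S x y -> P y -> e y z -> S z -> P z) ->
  forall y, linked e S x y -> P y.
Proof.
move=> Px Pstep y [p]; elim/last_ind: p y => [|p z IH] y [pp lp pS].
  by rewrite -lp; apply/Px/pS; rewrite inE eqxx.
move: pp lp; rewrite rcons_path last_rcons => /andP[pp elz] <-.
have pS' t : t \in x :: p -> S t.
  by move=> tp; apply: pS; rewrite -rcons_cons mem_rcons inE tp orbT.
apply: (Pstep (last x p)) => //; first by exists p.
  by apply: IH; split.
by apply: pS; rewrite -rcons_cons mem_rcons inE eqxx.
Qed.

Lemma linked_trans e S x y z :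
  linked e S x y -> linked e S y z -> linked e S x z.
Proof.
move=> xy; elim/linked_ind => [//|u v _ xu euv Sv].
exact: linked_step xu euv Sv.
Qed.

Lemma linked_mono e S T x y : S `<=` T -> linked e S x y -> linked e T x y.
Proof. by move=> ST [p [pp lp pS]]; exists p; split=> // z /pS/ST. Qed.

Lemma linked_sym e S x y : symmetric e -> linked e S x y -> linked e S y x.
Proof.
move=> es; elim/linked_ind => [Sx|u v xu ux euv Sv]; first exact: linked_refl.
apply: (linked_trans _ ux).
apply: (linked_step (linked_refl e Sv) _ (linked_right xu)); by rewrite es.
Qed.

(** A path from [x] inside [S] stays inside the component of [x]. *)
Lemma linked_linked e S x y : linked e S x y -> linked e (linked e S x) x y.
Proof.
elim/linked_ind => [Sx|u v xu ux euv Sv]; first exact/linked_refl/linked_refl.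
by apply: (linked_step ux euv); apply: (linked_step xu euv Sv).
Qed.

Lemma component_linked e S D x y : symmetric e ->
  component e S D -> D x -> D y -> linked e S x y.
Proof.
move=> es [a _ ->] ax ay; exact: linked_trans (linked_sym es ax) ay.
Qed.

Lemma component_eq e S C D z : symmetric e ->
  component e S C -> component e S D -> C z -> D z -> C = D.
Proof.
move=> es [x _ ->] [y _ ->] xz yz.
have xy := linked_trans xz (linked_sym es yz).
by apply/seteqP; split=> t; apply: linked_trans => //; exact: linked_sym.
Qed.

Lemma component_step e S D x y :
  component e S D -> D x -> e x y -> S y -> D y.
Proof. by move=> [a _ ->]; exact: linked_step. Qed.

Lemma component_sub e S D : component e S D -> D `<=` S.
Proof. by move=> [a _ ->] x /linked_right. Qed.

Lemma cutset_not_linked e x y Gamma :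
  cutset e x y Gamma <-> ~ linked e (~` Gamma) x y.
Proof.
split=> [cut [p [pp lp pG]]|nl p pp lp].
  by have [z /pG] := cut p pp lp.
apply: contrapT => nz; apply: nl; exists p; split=> // z zp Gz.
by apply: nz; exists z.
Qed.

End linked.

Definition locally_finite {V : eqType} (e : rel V) :=
  forall x, finite_set [set y | e x y].

(** * Deleting finitely many vertices *)

Section finite_deletion.
Context {V : choiceType} {e : rel V} (e_lf : locally_finite e).
Implicit Types (S Gamma : set V) (x y : V).

(** Deleting finitely many vertices cuts an infinite component into pieces,
each of which contains [x] or a neighbour of a deleted vertex; by local
finiteness there are finitely many pieces, so one of them is infinite. *)
Lemma infinite_linked_setD S Gamma x : finite_set Gamma ->
  infinite_set (linked e S x) ->
  exists2 y, linked e S x y & infinite_set (linked e (S `\` Gamma) y).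
Proof.
move=> finG infx; apply: contrapT => nex.
have fin y : linked e S x y -> finite_set (linked e (S `\` Gamma) y).
  by move=> xy; apply: contrapT => infy; apply: nex; exists y.
pose N := linked e S x `&` (x |` \bigcup_(g in Gamma) [set y | e g y]).
have finN : finite_set N.
  apply: sub_finite_set (@subIsetr _ _ _) _.
  rewrite finite_setU; split; first exact: finite_set1.
  exact: bigcup_finite.
apply: infx.
pose U := Gamma `|` \bigcup_(y in N) linked e (S `\` Gamma) y.
apply: (@sub_finite_set _ _ U).
  move=> z xz; suff [] : U z /\ linked e S x z by [].
  move: z xz; apply: linked_ind => [Sx|y z xy [yP _] eyz Sz].
    have xx := linked_refl e Sx; split=> //.
    have [Gx|Gx] := pselect (Gamma x); first by left.
    right; exists x; first by split=> //; left.
    exact: linked_refl.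
  have xz := linked_step xy eyz Sz; split=> //.
  have [Gz|Gz] := pselect (Gamma z); first by left.
  right; case: yP => [Gy|[n Nn ny]].
    exists z; last exact: linked_refl.
    by split=> //; right; exists y.
  by exists n => //; apply: (linked_step ny eyz _).
rewrite finite_setU; split=> //; apply: bigcup_finite => // y [xy _].
exact: fin.
Qed.

End finite_deletion.

(** * The boundary between two infinite connected sets *)

Section boundary.
Context {V : choiceType} {e : rel V} (e_sym : symmetric e).
Implicit Types (S C D Gamma : set V) (x y : V).

Definition boundary C D : set V := [set v | D v /\ exists2 u, C u & e u v].

Lemma boundaryI C D u v : D v -> C u -> e v u -> boundary C D v.
Proof. by move=> Dv Cu evu; split=> //; exists u; rewrite // e_sym. Qed.

Variables C D : set V.
Hypotheses (C_conn : connected_in e C) (C_ex : C !=set0).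
Hypothesis D_comp : component e (~` C) D.

Let B := boundary C D.

Lemma boundary_sub : B `<=` D. Proof. by move=> v []. Qed.

Lemma boundary_disjoint : C `<=` ~` B.
Proof. by move=> v Cv /boundary_sub/(component_sub D_comp); apply. Qed.

(** The part of the boundary seen from a component [K] of [D] minus the
boundary. It separates [K] from [C], and minimally so: a boundary vertex [w]
next to [K] is joined to [C] by one edge, to [K] by another, and neither [C]
nor [K] meets the boundary. *)
Lemma minimal_cutset_boundary a z : C a ->
  (D `\` B) z ->
  minimal_cutset e a z
    [set w | B w /\ exists2 n, linked e (D `\` B) z n & e w n].
Proof.
move=> Ca DBz; set K := linked e (D `\` B) z; set G := [set w | _].
have KD : K `<=` D `\` B by move=> t /linked_right.
split.
  apply/cutset_not_linked => /(linked_sym e_sym) za.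
  suff /KD[] : K a by move=> /(component_sub D_comp)/(_ Ca).
  move: a za {Ca}; apply: linked_ind => [_|t t' _ Kt ett' nGt'].
    exact: linked_refl.
  have [Dt nBt] := KD _ Kt.
  have Dt' : D t'.
    apply: (component_step D_comp Dt ett' _) => Ct'.
    exact: nBt (boundaryI Dt Ct' ett').
  apply: (linked_step Kt ett' _); split=> // Bt'; apply: nGt'; split=> //.
  by exists t; rewrite // e_sym.
move=> w [Bw [n Kn ewn]] /cutset_not_linked; apply.
have [_ [u Cu euw]] := Bw.
have GB : ~` B `<=` ~` (G `\ w) by move=> v nBv [[Bv _] _]; exact: nBv.
have au : linked e (~` (G `\ w)) a u.
  by apply: (linked_mono _ (C_conn Ca Cu)) => v /boundary_disjoint/GB.
have aw : linked e (~` (G `\ w)) a w.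
  by apply: (linked_step au euw _) => -[_]; apply.
have an : linked e (~` (G `\ w)) a n.
  by apply: (linked_step aw ewn _); apply: GB; have [] := KD _ Kn.
apply: (linked_trans an _); apply: linked_sym => //.
by apply: (linked_mono _ Kn) => v [_ /GB].
Qed.

(** A path of [D] between two boundary vertices alternates between steps inside
the boundary and excursions into components of [D] minus the boundary. An
excursion starts and ends in one and the same minimal cutset, hence its
endpoints are also joined inside the boundary. *)
Lemma connected_boundary : connected_minimal_cutsets e -> connected_in e B.
Proof.
move=> cuts w v Bw Bv.
have [a Ca] := C_ex.
suff : (B v -> linked e B w v) /\ (~ B v -> exists2 w0, linked e B w w0 &
  exists2 n, linked e (D `\` B) v n & e w0 n) by case=> /(_ Bv).
have wv := component_linked e_sym D_comp (boundary_sub Bw) (boundary_sub Bv).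
move: v wv {Bv}; apply: linked_ind => [_|t t' wt [tB tnB] ett' nCt'].
  by split=> // _; exact: linked_refl.
have Dt : D t.
  have [d _ DE] := D_comp; have := boundary_sub Bw; rewrite DE => dw.
  exact: linked_trans dw wt.
have Dt' : D t' := component_step D_comp Dt ett' nCt'.
have [Bt|nBt] := pselect (B t); split=> Bt'.
- exact: linked_step (tB Bt) ett' Bt'.
- by exists t; [exact: tB|exists t' => //; exact: linked_refl].
- have [w0 ww0 [n tn ew0n]] := tnB nBt.
  have [DBt Bw0] : (D `\` B) t /\ B w0 by split=> //; exact: linked_right ww0.
  have min := minimal_cutset_boundary Ca DBt.
  apply: (linked_trans ww0 _).
  apply: (linked_mono _ (cuts _ _ _ min _ _ _ _)); first by move=> ? [].
    by split=> //; exists n.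
  by split=> //; exists t; [exact: linked_refl|rewrite e_sym].
- have [w0 ww0 [n tn ew0n]] := tnB nBt.
  exists w0 => //; exists n => //; apply: (linked_trans _ tn).
  by apply: (linked_step (linked_refl e _) _ _) => //; rewrite e_sym.
Qed.

(** Removing a finite boundary would leave an infinite component inside [D] and
another one around [C]. *)
Lemma infinite_boundary : locally_finite e -> one_ended e ->
  infinite_set C -> infinite_set D -> infinite_set B.
Proof.
move=> e_lf one infC infD finB.
have [a Ca] := C_ex.
have [d _ DE] := D_comp.
have [n] : exists2 n, linked e (~` C) d n &
    infinite_set (linked e (~` C `\` B) n).
  by apply: infinite_linked_setD => //; rewrite -DE.
rewrite -DE => Dn infn.
have nBn : ~ B n.
  move=> Bn; apply: infn; rewrite (_ : linked _ _ _ = set0) // -subset0.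
  by move=> t /linked_left[].
have [E [_ uniqE]] := one _ finB.
have En : E = linked e (~` B) n.
  apply: uniqE; split; first by exists n.
  by apply: sub_infinite_set infn => t; apply: linked_mono => v [].
have Ea : E = linked e (~` B) a.
  apply: uniqE; split; first by exists a => //; exact: boundary_disjoint.
  apply: sub_infinite_set infC => t Ct.
  exact: linked_mono boundary_disjoint (C_conn Ca Ct).
have na : linked e (~` B) n a.
  by rewrite -En Ea; apply/linked_refl/boundary_disjoint.
suff /(component_sub D_comp) : D a by apply.
move: a na {Ca Ea}; apply: linked_ind => // t t' nt Dt ett' nBt'.
apply: (component_step D_comp Dt ett' _) => Ct'.
exact: (linked_right nt) (boundaryI Dt Ct' ett').
Qed.

End boundary.

(** The boundary of an infinite component [C] of [S] in an infinite component
of the complement of [C] avoids [S], is infinite, and is connected; hence it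
lies in an infinite component of [~` S]. *)
Lemma infinite_component_complement {V : choiceType} (e : rel V)
    (S C D : set V) :
  symmetric e -> locally_finite e -> one_ended e ->
  connected_minimal_cutsets e ->
  infinite_component e S C -> infinite_component e (~` C) D ->
  exists E, infinite_component e (~` S) E.
Proof.
move=> e_sym e_lf one cuts [C_comp infC] [D_comp infD].
have C_conn : connected_in e C.
  have [c _ CE] := C_comp; move=> x y; rewrite CE => cx cy.
  exact: linked_trans (linked_sym e_sym (linked_linked cx)) (linked_linked cy).
have C_ex : C !=set0 by exact: infinite_setN0.
have infB := infinite_boundary e_sym C_conn C_ex D_comp e_lf one infC infD.
have B_conn := connected_boundary e_sym C_conn C_ex D_comp cuts.
have BS : @boundary V e C D `<=` ~` S.
  move=> v [Dv [u Cu euv]] Sv.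
  exact: (component_sub D_comp Dv) (component_step C_comp Cu euv Sv).
have [b Bb] := infinite_setN0 infB.
exists (linked e (~` S) b); split; first by exists b => //; exact: BS.
apply: sub_infinite_set infB => v Bv.
exact: linked_mono BS (B_conn _ _ Bb Bv).
Qed.

(** * Measurability of percolation events *)

Section measurable_events.
Context {d : measure_display} {X : measurableType d} {V : countType}.
Implicit Types (S : X -> set V).

Lemma measurable_ex (T : countType) (F : T -> set X) :
  (forall t, measurable (F t)) -> measurable [set w | exists t, F t w].
Proof.
move=> mF; rewrite (_ : [set w | _] = \bigcup_t F t).
  by apply: countable_bigcupT_measurable => //; exact: countableP.
by apply/seteqP; split=> w [t]; [exists t|move=> _ ?; exists t].
Qed.

Lemma measurable_all (T : countType) (F : T -> set X) :
  (forall t, measurable (F t)) -> measurable [set w | forall t, F t w].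
Proof.
move=> mF; rewrite (_ : [set w | _] = ~` [set w | exists t, (~` F t) w]).
  by apply/measurableC/measurable_ex => t; exact: measurableC.
apply/seteqP; split=> w /= Fw; first by move=> [t]; apply.
by move=> t; apply: contrapT => nF; apply: Fw; exists t.
Qed.

Lemma measurable_imply (F G : set X) :
  measurable F -> measurable G -> measurable [set w | F w -> G w].
Proof.
move=> mF mG; rewrite (_ : [set w | _] = ~` F `|` G).
  by apply: measurableU => //; exact: measurableC.
apply/seteqP; split=> w /=; last by move=> [nF /nF|].
by move=> FG; have [/FG|] := pselect (F w); [right|left].
Qed.

Lemma measurable_cst_prop (Q : Prop) : measurable [set _ : X | Q].
Proof.
have [q|nq] := pselect Q.
  by rewrite (_ : [set _ | _] = setT) //; apply/seteqP; split.
by rewrite (_ : [set _ | _] = set0) //; apply/seteqP; split.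
Qed.

(** Finite lists over a countable type are countably many, so this turns
infiniteness into a countable combination of conditions. *)
Lemma infinite_set_seqP (D : set V) :
  infinite_set D <-> forall s : seq V, exists v, D v /\ v \notin s.
Proof.
split=> [infD s|notin /finite_seqP[s DE]].
  apply: contrapT => nex; apply: infD; apply: sub_finite_set (finite_seq s).
  by move=> v Dv; apply: contrapT => /negP vs; apply: nex; exists v.
by have [v [+ /negP]] := notin s; rewrite DE.
Qed.

Variable e : rel V.

Section linked_events.
Variable S : X -> set V.
Hypothesis mS : forall v, measurable [set w | S w v].

Lemma measurable_infinite_set : measurable [set w | infinite_set (S w)].
Proof.
rewrite (_ : [set w | _] =
  [set w | forall s : seq V, exists v, S w v /\ v \notin s]).
  apply: measurable_all => s; apply: measurable_ex => v.
  apply: measurableI; first exact: mS.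
  exact: (measurable_cst_prop (v \notin s)).
by apply/seteqP; split=> w /infinite_set_seqP.
Qed.

Lemma measurable_linked x y : measurable [set w | linked e (S w) x y].
Proof.
pose F p : set X := [set w | [/\ path e x p, last x p = y &
    forall z, z \in x :: p -> S w z]].
apply: (@measurable_ex (seq V) F) => p.
rewrite (_ : F p = [set _ | path e x p /\ last x p = y] `&`
    [set w | forall z, z \in x :: p -> S w z]).
  apply: measurableI; first exact: measurable_cst_prop.
  apply: measurable_all => z; apply: measurable_imply.
    exact: (measurable_cst_prop (z \in x :: p)).
  exact: mS.
by apply/seteqP; split=> w /=; [case|case=> -[]].
Qed.

End linked_events.

Lemma measurable_infinite_linked S : (forall v, measurable [set w | S w v]) ->
  forall x, measurable [set w | infinite_set (linked e (S w) x)].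
Proof.
by move=> mS x; apply: measurable_infinite_set => v; exact: measurable_linked.
Qed.

Lemma infinite_componentP (D : set V) :
  (exists C, infinite_component e D C) <->
  exists x, infinite_set (linked e D x).
Proof.
split=> [[_ [[x _ ->] infx]]|[x infx]]; first by exists x.
exists (linked e D x); split=> //; exists x => //.
by have [y /linked_left] := infinite_setN0 infx.
Qed.

Lemma measurable_infinite_component S :
  (forall v, measurable [set w | S w v]) ->
  measurable [set w | exists C, infinite_component e (S w) C].
Proof.
move=> mS; rewrite (_ : [set w | _] =
  [set w | exists x, infinite_set (linked e (S w) x)]).
  by apply: measurable_ex => x; exact: measurable_infinite_linked.
by apply/seteqP; split=> w /infinite_componentP.
Qed.

End measurable_events.

Section config_events.
Context {V : countType} {e : rel V}.

Lemma measurable_open v : measurable [set w : config V | w v].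
Proof. by apply: sub_sigma_algebra; exists v. Qed.

Lemma measurable_to_config {d} {X : measurableType d} (f : X -> config V) :
  (forall v, measurable [set x | f x v]) -> measurable_fun setT f.
Proof.
move=> mf; apply: (@measurability _ _ X (config V) setT f (@cylinders V)) => //.
by move=> _ [_ [v _ <-] <-]; rewrite setTI; exact: mf.
Qed.

Lemma measurable_some_infinite_cluster :
  measurable (@some_infinite_cluster V e).
Proof. exact: (measurable_infinite_component e measurable_open). Qed.

Lemma measurable_unique_infinite_cluster : symmetric e ->
  measurable (@unique_infinite_cluster V e).
Proof.
move=> es; pose I x : set (config V) :=
  [set w | infinite_set (linked e [set v | w v] x)].
have mI x : measurable (I x).
  exact: measurable_infinite_linked measurable_open x.
rewrite (_ : unique_infinite_cluster e = [set w | exists x, I x w] `&`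
  [set w | forall x y, I x w -> I y w -> linked e [set v | w v] x y]).
  apply: measurableI; first exact: measurable_ex.
  apply: measurable_all => x; apply: measurable_all => y.
  apply: measurable_imply => //; apply: measurable_imply => //.
  exact: (measurable_linked _ measurable_open).
apply/seteqP; split=> w /=.
  move=> [C [infC uniqC]]; split; first by apply/infinite_componentP; exists C.
  have IC x : I x w -> C = linked e [set v | w v] x.
    move=> Ix; apply: uniqC; split=> //; exists x => //.
    by have [y /linked_left] := infinite_setN0 Ix.
  move=> x y Ix Iy; rewrite -(IC x) // (IC y) //; apply: linked_refl.
  by have [z /linked_left] := infinite_setN0 Iy.
move=> [/infinite_componentP[C infC] uniq]; exists C; split=> // D infD.
have [[x _ CE] Ix] := infC; have [[y _ DE] Iy] := infD.
have xy : linked e [set v | w v] x y by apply: uniq; rewrite /I/= -?CE -?DE.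
rewrite CE DE; apply/seteqP; split=> z; apply: linked_trans => //.
exact: linked_sym.
Qed.

Lemma measurable_cluster_without_infinite_complement :
  measurable (@cluster_without_infinite_complement V e).
Proof.
pose K x (w : config V) := linked e [set v | w v] x.
have mK x v : measurable [set w | K x w v].
  exact: (measurable_linked _ measurable_open).
rewrite (_ : cluster_without_infinite_complement e =
  [set w | exists x, ([set w | infinite_set (K x w)] `&`
    ~` [set w | exists D, infinite_component e (~` K x w) D]) w]).
  apply: measurable_ex => x; apply: measurableI.
    exact: measurable_infinite_set.
  apply/measurableC/measurable_infinite_component => v.
  exact: measurableC (mK x v).
apply/seteqP; split=> w /=.
  by move=> [_ [[x _ ->] infx] nD]; exists x.
move=> [x [infx nD]]; exists (K x w) => //; split=> //; exists x => //.
by have [y /linked_left] := infinite_setN0 infx.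
Qed.

End config_events.

(** * Bernoulli configurations *)

Section bernoulli.
Context {R : realType} {V : countType}.
Implicit Types (p q : R) (P Q : probability (config V) R) (L : seq V).

Definition all_closed L : set (config V) :=
  [set w | forall v, v \in L -> w v = false].

Lemma measurable_all_closed L : measurable (all_closed L).
Proof.
apply: measurable_all => v; apply: measurable_imply.
  exact: (measurable_cst_prop (v \in L)).
rewrite (_ : (fun w : config V => w v = false) = ~` [set w | w v]).
  exact: measurableC (measurable_open v).
by apply/seteqP; split=> w /=; [move=> ->|move/negP/negbTE].
Qed.

(** The events [all_closed L] are stable under intersection and contain the
complements of the generators of the sigma-algebra, so they determine a finite
measure. *)
Lemma config_measure_unique (m1 m2 : measure (config V) R) :
  (m1 setT < +oo)%E ->
  (forall L, m1 (all_closed L) = m2 (all_closed L)) ->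
  forall A, measurable A -> m1 A = m2 A.
Proof.
move=> m1fin m12; have closedT : all_closed [::] = setT by apply/seteqP; split.
apply: (measure_unique [set A | exists L, A = all_closed L] (fun=> setT)).
- apply/seteqP; split; last first.
    apply: smallest_sub; first exact: sigma_algebra_measurable.
    by move=> _ [L ->]; exact: measurable_all_closed.
  apply: smallest_sub; first exact: smallest_sigma_algebra.
  move=> _ [v _ <-].
  rewrite (_ : [set w : config V | _] = setT `\` all_closed [:: v]).
    have [_ + _] := smallest_sigma_algebra setT
      [set A | exists L, A = all_closed L].
    by apply; apply: sub_sigma_algebra; exists [:: v].
  rewrite setTD; apply/seteqP; split=> w /=.
    by move=> wv /(_ v); rewrite wv inE eqxx => /(_ isT).
  move=> nw; apply: contrapT => /negP/negbTE wv; apply: nw => u.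
  by rewrite inE => /eqP->.
- move=> _ _ [L ->] [M ->]; exists (L ++ M); apply/seteqP; split=> w.
    by move=> [wL wM] v; rewrite mem_cat => /orP[/wL|/wM].
  by move=> wLM; split=> v vLM; apply: wLM; rewrite mem_cat vLM ?orbT.
- by move=> _; exists [::].
- by rewrite bigcup_const.
- by move=> _ [L ->].
- by [].
Qed.

Lemma config_probability_unique P Q :
  (forall L, P (all_closed L) = Q (all_closed L)) ->
  forall A, measurable A -> P A = Q A.
Proof.
move=> PQ A mA; apply: config_measure_unique => //.
by rewrite ltey_eq fin_num_measure.
Qed.

Lemma bernoulli_all_closed p P L : bernoulli_site p P ->
  P (all_closed L) = ((1 - p) ^+ size (undup L))%:E.
Proof.
move=> bP; rewrite (_ : all_closed L =
  [set w | forall v, v \in undup L -> w v = false]).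
  rewrite (bP _ (fun=> false) (undup_uniq L)) /bernoulli_pmf.
  by rewrite big_const_seq count_predT iter_mulr_1.
by apply/seteqP; split=> w wL v vL; apply: wL; move: vL; rewrite mem_undup.
Qed.

Lemma bernoulli_all_open p P L : bernoulli_site p P ->
  P [set w | forall v, v \in L -> w v = true] = (p ^+ size (undup L))%:E.
Proof.
move=> bP; rewrite (_ : [set w : config V | _] =
  [set w | forall v, v \in undup L -> w v = true]).
  rewrite (bP _ (fun=> true) (undup_uniq L)) /bernoulli_pmf.
  by rewrite big_const_seq count_predT iter_mulr_1.
by apply/seteqP; split=> w wL v vL; apply: wL; move: vL; rewrite mem_undup.
Qed.

Lemma pushforward_probability {d} {X : measurableType d} (P : probability X R)
  (f : X -> config V) : measurable_fun setT f ->
  exists Q : probability (config V) R, forall A, Q A = P (f @^-1` A).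
Proof.
move=> mf.
pose F : {mfun X >-> config V} :=
  HB.pack f (isMeasurableFun.Build _ _ _ _ f mf).
by exists (distribution P F).
Qed.

Definition flip (w : config V) : config V := fun v => ~~ w v.

Lemma measurable_flip : measurable_fun setT flip.
Proof.
apply: measurable_to_config => v.
rewrite (_ : [set w | _] = ~` [set w : config V | w v]).
  exact: measurableC (measurable_open v).
by apply/seteqP; split=> w /= /negP.
Qed.

Lemma bernoulli_flip p P Q : bernoulli_site p P -> bernoulli_site (1 - p) Q ->
  forall A, measurable A -> P (flip @^-1` A) = Q A.
Proof.
move=> bP bQ A mA; have [P' P'E] := pushforward_probability P measurable_flip.
rewrite -P'E; apply: config_probability_unique => // L.
rewrite P'E (bernoulli_all_closed _ bQ) (_ : 1 - (1 - p) = p); last by lra.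
rewrite -(bernoulli_all_open _ bP); congr (P _).
by apply/seteqP; split=> w wL v /wL; rewrite /flip; case: (w v).
Qed.

Definition joint_open (w : config V * config V) : config V :=
  fun v => w.1 v || w.2 v.

Lemma measurable_joint_open : measurable_fun setT joint_open.
Proof.
apply: measurable_to_config => v.
have m1 : measurable_fun setT (@fst (config V) (config V)) by [].
have m2 : measurable_fun setT (@snd (config V) (config V)) by [].
rewrite (_ : [set w | _] = (setT `&` fst @^-1` [set w : config V | w v]) `|`
  (setT `&` snd @^-1` [set w : config V | w v])).
  by apply: measurableU; [apply: m1|apply: m2] => //; exact: measurable_open.
by rewrite !setTI; apply/seteqP; split=> w /= /orP.
Qed.

(** Opening, on top of a configuration of parameter [q], each vertex
independently with probability [(p - q) / (1 - q)] gives parameter [p]. *)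
Lemma bernoulli_increasing p q P Q A : 0 <= q -> q <= p -> p <= 1 ->
  bernoulli_site p P -> bernoulli_site q Q ->
  measurable A ->
  (forall w w' : config V, (forall v, w v -> w' v) -> A w -> A w') ->
  (Q A <= P A)%E.
Proof.
move=> q0 qp p1 bP bQ mA incA.
pose r := (p - q) / (1 - q).
have r01 : 0 <= r <= 1.
  have [q1|q1] := ltP q 1; last first.
    by rewrite /r (_ : p - q = 0) ?mul0r ?lexx //; lra.
  by rewrite /r ler_pdivlMr ?ler_pdivrMr; lra.
have rE : (1 - q) * (1 - r) = 1 - p.
  have [q1|q1] := ltP q 1; last first.
    by rewrite (_ : 1 - q = 0) ?mul0r; lra.
  by rewrite /r; field; lra.
have bU := @site_lawP V R r r01; set U := site_law V r in bU.
have [P' P'E] := pushforward_probability (Q \x U)%E measurable_joint_open.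
have -> : P A = P' A.
  apply: config_probability_unique => // L.
  rewrite P'E (bernoulli_all_closed _ bP) -rE exprMn EFinM.
  rewrite -(bernoulli_all_closed _ bQ) -(bernoulli_all_closed _ bU).
  rewrite -product_measure1E; try exact: measurable_all_closed.
  congr (product_measure1 _ _ _); apply/seteqP; split=> w /=.
    by move=> [w1 w2] v vL; rewrite /joint_open w1 ?w2.
  move=> wL; split=> v /wL; rewrite /joint_open; first by case: (w.1 v).
  by case: (w.2 v); rewrite ?orbT.
rewrite P'E -[leLHS]mule1 -(@probability_setT _ _ _ U) -product_measure1E //.
apply: le_measure; rewrite ?inE.
- exact: measurableX.
- by rewrite -[X in measurable X]setTI; exact: measurable_joint_open.
- move=> w [Aw _]; apply: incA Aw => v; rewrite /joint_open => ->//.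
Qed.

Definition close_on L (w : config V) : config V :=
  fun v => (v \notin L) && w v.

Lemma measurable_close_on L : measurable_fun setT (close_on L).
Proof.
apply: measurable_to_config => v; rewrite /close_on; case: (v \notin L) => /=.
  exact: measurable_open.
exact: measurable_cst_prop.
Qed.

(** Kolmogorov's zero-one law for events insensitive to closing finitely many
vertices. Restricted to [all_closed L], the measure [P] is a multiple of the law
of [close_on L w], as can be tested on the events [all_closed M]; so [A] is
independent of each [all_closed L], and, by uniqueness again, of itself. *)
Lemma bernoulli_zero_one p P A : 0 <= p <= 1 -> bernoulli_site p P ->
  measurable A -> (forall L w, A (close_on L w) <-> A w) ->
  P A = 0%E \/ P A = 1%E.
Proof.
move=> /andP[p0 p1] bP mA tailA.
have indep L : P (A `&` all_closed L) = (P (all_closed L) * P A)%E.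
  have [Q QE] := pushforward_probability P (measurable_close_on L).
  have c0 : 0 <= (1 - p) ^+ size (undup L) by rewrite exprn_ge0 // subr_ge0.
  have -> : P A = Q A.
    by rewrite QE; congr (P _); apply/seteqP; split=> w Aw; apply/(tailA L).
  rewrite (bernoulli_all_closed _ bP).
  rewrite -[LHS]/(mrestr P (measurable_all_closed L) A).
  rewrite -[RHS]/(mscale (NngNum c0) Q A).
  apply: config_measure_unique => //=.
    rewrite /mrestr setTI ltey_eq fin_num_measure //.
    exact: measurable_all_closed.
  move=> M; rewrite /mrestr /mscale /= QE.
  rewrite (_ : _ `&` _ = all_closed (M ++ L)); last first.
    apply/seteqP; split=> w.
      by move=> [wM wL] v; rewrite mem_cat => /orP[/wM|/wL].
    by move=> wLM; split=> v vLM; apply: wLM; rewrite mem_cat vLM ?orbT.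
  rewrite (_ : _ @^-1` _ = all_closed [seq v <- M | v \notin L]); last first.
    apply/seteqP; split=> w /= wM v.
      by rewrite mem_filter => /andP[vL /wM]; rewrite /close_on vL.
    move=> vM; rewrite /close_on; case vL: (v \notin L) => //=.
    by apply: wM; rewrite mem_filter vL.
  rewrite !(bernoulli_all_closed _ bP) -EFinM -exprD; congr (_ ^+ _)%:E.
  by rewrite undup_cat size_cat addnC filter_undup.
have PAE : P A = (fine (P A))%:E by rewrite fineK // fin_num_measure.
have a0 : 0 <= fine (P A) by exact: fine_ge0.
have : mrestr P mA A = mscale (NngNum a0) P A.
  apply: config_measure_unique => //=.
    by rewrite /mrestr setTI ltey_eq fin_num_measure.
  by move=> L; rewrite /mrestr /mscale /= setIC indep muleC -PAE.
rewrite /mrestr /mscale /= setIid PAE -EFinM => -[/eqP].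
rewrite -subr_eq0 -{1}[fine _]mulr1 -mulrBr mulf_eq0 subr_eq0.
by case/orP => /eqP; [move=> ->; left|move=> <-; right].
Qed.

End bernoulli.

(** * Critical values *)

Section critical_values.
Context {R : realType} {V : countType} {e : rel V}.
Implicit Types (p q : R) (w : config V).

Lemma some_infinite_cluster_mono w w' : (forall v, w v -> w' v) ->
  some_infinite_cluster e w -> some_infinite_cluster e w'.
Proof.
move=> ww' /infinite_componentP[x infx]; apply/infinite_componentP; exists x.
by apply: sub_infinite_set infx => y; exact: linked_mono.
Qed.

(** Local finiteness matters here: closing a vertex of infinite degree can
break an infinite cluster into infinitely many finite ones. *)
Lemma some_infinite_cluster_close_on (L : seq V) w : locally_finite e ->
  some_infinite_cluster e (close_on L w) <-> some_infinite_cluster e w.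
Proof.
move=> e_lf; split.
  by apply: some_infinite_cluster_mono => v /andP[].
move=> /infinite_componentP[x infx]; apply/infinite_componentP.
have [y _ infy] := infinite_linked_setD e_lf (finite_seq L) infx.
exists y; apply: sub_infinite_set infy => z.
by apply: linked_mono => v [wv /negP vL]; exact/andP.
Qed.

Lemma has_sup_unit (A : set R) : (forall p, A p -> 0 <= p <= 1) ->
  A !=set0 -> has_sup A.
Proof. by move=> A01 A0; split=> //; exists 1 => p /A01/andP[]. Qed.

Lemma sup_subset_unit (A B : set R) : (forall p, B p -> 0 <= p <= 1) ->
  A `<=` B -> sup A <= sup B.
Proof.
move=> B01 AB.
have [->|/set0P[p Ap]] := eqVneq A set0; last first.
  apply: sup_le; [by move=> q /AB Bq; exists q|by exists p|].
  by apply: has_sup_unit => //; exists p; exact: AB.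
rewrite sup0; have [->|/set0P[p Bp]] := eqVneq B set0; first by rewrite sup0.
have /andP[p0 _] := B01 _ Bp; apply: le_trans p0 _.
by apply: sup_upper_bound => //; apply: has_sup_unit => //; exists p.
Qed.

Lemma site_law_gt_p_c p : 0 <= p <= 1 -> p_c R e < p ->
  site_law V p (some_infinite_cluster e) <> 0%E.
Proof.
move=> p01 + P0; apply/negP; rewrite -leNgt; apply: sup_upper_bound => //.
by apply: has_sup_unit => [q []//|]; exists p.
Qed.

Lemma site_law_lt_p_c p : 0 <= p -> p < p_c R e ->
  site_law V p (some_infinite_cluster e) = 0%E.
Proof.
move=> p0 ppc; rewrite /p_c in ppc.
have [|q [/andP[q0 q1] Pq] pq] := sup_gt _ ppc.
  apply/set0P/eqP => A0; move: ppc; rewrite A0 sup0; lra.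
apply/eqP; rewrite eq_le measure_ge0 andbT -Pq.
apply: (bernoulli_increasing p0 (ltW pq) q1).
- by apply: site_lawP; lra.
- by apply: site_lawP; lra.
- exact: measurable_some_infinite_cluster.
- exact: some_infinite_cluster_mono.
Qed.

Lemma infinite_set_uniq_seq (A : set V) n : infinite_set A ->
  exists L : seq V, [/\ uniq L, size L = n & forall u, u \in L -> A u].
Proof.
move=> infA; elim: n => [|n [L [uL sL LA]]]; first by exists [::].
have /infinite_set_seqP/(_ L)[u [Au uL']] := infA.
exists (u :: L); split=> /=; [by rewrite uL'|by rewrite sL|].
by move=> v; rewrite inE => /orP[/eqP->//|/LA].
Qed.

(** Any [n] vertices of [A] are all closed with probability [(1 - p) ^+ n]. *)
Lemma bernoulli_all_closed_infinite p (P : probability (config V) R)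
    (A : set V) F :
  0 < p <= 1 -> bernoulli_site p P -> infinite_set A -> measurable F ->
  (forall w, F w -> forall u, A u -> w u = false) -> P F = 0%E.
Proof.
move=> /andP[p0 p1] bP infA mF FA.
have PFE : P F = (fine (P F))%:E by rewrite fineK // fin_num_measure.
have le n : fine (P F) <= (1 - p) ^+ n.
  have [L [uL sL LA]] := infinite_set_uniq_seq n infA.
  rewrite -lee_fin -PFE -sL -(undup_id uL) -(bernoulli_all_closed _ bP).
  apply: le_measure; rewrite ?inE //; first exact: measurable_all_closed.
  by move=> w Fw u /LA; exact: FA.
rewrite PFE; congr (_%:E); apply/eqP.
rewrite eq_le (fine_ge0 (measure_ge0 P F)) andbT leNgt; apply/negP => F0.
have q1 : `|1 - p| < 1 by rewrite ger0_norm; lra.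
have /cvgr0_norm_lt/(_ _ F0)[n _ /(_ n (leqnn n))] := cvg_expr q1.
by rewrite /= ger0_norm ?exprn_ge0 ?subr_ge0 // ltNge le.
Qed.

(** A vertex of infinite degree, once open, has infinitely many open neighbours
almost surely, for any positive parameter. *)
Lemma p_c_infinite_degree : ~ locally_finite e -> p_c R e <= 0.
Proof.
move=> nlf.
have [v infv] : exists v, infinite_set [set u | e v u].
  apply: contrapT => nex; apply: nlf => v.
  by apply: contrapT => infv; apply: nex; exists v.
rewrite /p_c; set A := [set p | _].
have [->|/set0P A0] := eqVneq A set0; first by rewrite sup0.
apply: ge_sup => // p [p01 P0]; rewrite leNgt; apply/negP => p0.
have bP := @site_lawP V R p p01.
pose F (s : seq V) : set (config V) :=
  [set w | forall u, e v u /\ u \notin s -> w u = false].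
have mF s : measurable (F s).
  apply: measurable_all => u; apply: measurable_imply.
    exact: (measurable_cst_prop (e v u /\ u \notin s)).
  rewrite (_ : (fun w : config V => _) = all_closed [:: u]); last first.
    apply/seteqP; split=> w /=; first by move=> wu z; rewrite inE => /eqP->.
    by apply; rewrite inE.
  exact: measurable_all_closed.
have PF s : site_law V p (F s) = 0%E.
  pose N := [set u | e v u /\ u \notin s].
  apply: (@bernoulli_all_closed_infinite _ _ N _ _ bP _ (mF s)) => //.
  - by move: p01 => /andP[_ ->]; rewrite p0.
  - suff : infinite_set ([set u | e v u] `\` [set` s]).
      by apply: sub_infinite_set => u [? /negP].
    exact: infinite_setD.
have open0 : site_law V p [set w : config V | w v] = 0%E.
  apply/negligibleP; first exact: measurable_open.
  (* If [v] is open and its cluster finite, then [F t] holds for a list [t] of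
     its open neighbours; lists are enumerated along [nat]. *)
  pose Fn n := if @unpickle (seq V) n is Some s then F s else set0.
  apply: (@negligibleS _ _ _ _ (some_infinite_cluster e `|` \bigcup_n Fn n)).
    move=> w wv; have [[t Ft]|nF] := pselect (exists t, F t w).
      by right; exists (pickle t) => //; rewrite /Fn pickleK.
    left; apply/infinite_componentP; exists v; apply/infinite_set_seqP => s.
    have /existsNP[u /not_implyP[[evu us] nwu]] : ~ F s w.
      by move=> Fs; apply: nF; exists s.
    exists u; split=> //; apply: (linked_step (linked_refl e wv) evu) => /=.
    by case: (w u) nwu.
  apply: negligibleU.
    by apply/negligibleP => //; exact: measurable_some_infinite_cluster.
  apply: negligible_bigcup => n; rewrite /Fn.
  case: unpickle => [s|]; last exact: negligible_set0.
  by apply/negligibleP; [exact: mF|exact: PF].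
have := bernoulli_all_open [:: v] bP; rewrite /= expr1.
rewrite (_ : [set w : config V | _] = [set w : config V | w v]).
  by rewrite open0 => -[p0E]; move: p0; rewrite -p0E ltxx.
apply/seteqP; split=> w /=; first by apply; rewrite inE.
by move=> wv u; rewrite inE => /eqP->.
Qed.

(** Any other infinite cluster would be an infinite connected subset of the
complement. *)
Lemma cluster_without_infinite_complement_unique : symmetric e ->
  cluster_without_infinite_complement e `<=` @unique_infinite_cluster V e.
Proof.
move=> e_sym w [C [C_comp infC] nD]; exists C; split=> // C' [C'_comp infC'].
have [[z [Cz C'z]]|disj] := pselect (exists z, C z /\ C' z).
  exact: component_eq C_comp C'_comp Cz C'z.
exfalso; apply: nD; apply/infinite_componentP.
have C'C : C' `<=` ~` C by move=> z C'z Cz; apply: disj; exists z.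
have [y _ C'E] := C'_comp; exists y; apply: sub_infinite_set infC' => z.
by rewrite {1}C'E => /linked_linked; rewrite -C'E; exact: linked_mono.
Qed.

(** Above [p_c] an infinite cluster exists almost surely, and for
[1 - p < p_c] the closed vertices, whose law has parameter [1 - p], contain
none. *)
Lemma site_law_cluster_without_infinite_complement p :
  symmetric e -> locally_finite e -> one_ended e ->
  connected_minimal_cutsets e ->
  0 <= p <= 1 -> p_c R e < p -> 1 - p < p_c R e ->
  site_law V p (cluster_without_infinite_complement e) = 1%E.
Proof.
move=> e_sym e_lf one cuts p01 pcp ppc.
have bP := @site_lawP V R p p01.
have p01' : 0 <= 1 - p <= 1 by lra.
have bQ := @site_lawP V R (1 - p) p01'.
have mI : measurable (@some_infinite_cluster V e).
  exact: measurable_some_infinite_cluster.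
have mE : measurable (@cluster_without_infinite_complement V e).
  exact: measurable_cluster_without_infinite_complement.
have mN : measurable (flip @^-1` @some_infinite_cluster V e).
  by rewrite -[X in measurable X]setTI; exact: measurable_flip.
have PI : site_law V p (some_infinite_cluster e) = 1%E.
  have [PI0|//] := bernoulli_zero_one p01 bP mI
    (fun L w => some_infinite_cluster_close_on L w e_lf).
  by have := site_law_gt_p_c p01 pcp PI0.
have PN : site_law V p (flip @^-1` some_infinite_cluster e) = 0%E.
  rewrite (bernoulli_flip bP bQ mI); apply: site_law_lt_p_c => //.
  by case/andP: p01'.
apply/eqP; rewrite eq_le probability_le1 //= -PI.
rewrite -[leRHS]adde0 -PN.
apply: le_trans (measureU2 _ mE mN); apply: le_measure; rewrite ?inE //.
  exact: measurableU.
move=> w [C infC]; have [|nN] := pselect (some_infinite_cluster e (flip w)).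
  by right.
left; exists C => // -[D infD]; apply: nN.
have [E infE] := infinite_component_complement e_sym e_lf one cuts infC infD.
exists E; rewrite /infinite_cluster (_ : [set v | _] = ~` [set v | w v]) //.
by apply/seteqP; split=> v /negP.
Qed.

End critical_values.

Theorem theorem2p4 (R : realType) (V : countType) (e : rel V)
    (e_sym : symmetric e) (e_irr : irreflexive e)
    (e_one_ended : one_ended e)
    (e_cutsets : connected_minimal_cutsets e) :
  p_u R e <= pbar_u R e /\ pbar_u R e <= Num.max (p_c R e) (1 - p_c R e).
Proof.
split.
  apply: sup_subset_unit => [p []//|p [p01 Pp]]; split=> //.
  apply: le_lt_trans Pp; apply: le_measure; rewrite ?inE.
  - exact: measurable_cluster_without_infinite_complement.
  - exact: measurable_unique_infinite_cluster.
  - exact: cluster_without_infinite_complement_unique.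
(* [sup set0 = 0], and the maximum is at least [1 / 2] anyway. *)
rewrite /pbar_u; set B := [set p | _].
have [->|/set0P B0] := eqVneq B set0.
  by rewrite sup0 le_max; have [//|] := leP 0 (p_c R e); lra.
apply: ge_sup => // p [p01 Pp].
rewrite leNgt gt_max; apply/negP => /andP[pcp ppc].
have [e_lf|/(@p_c_infinite_degree R)] := pselect (locally_finite e);
  last by lra.
move: Pp; rewrite site_law_cluster_without_infinite_complement ?ltxx //.
lra.
Qed.
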